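(* Let $(V_1,V_2)$ be a pair of commuting isometries on a Hilbert space $\mathcal{H}$. Let $i,j\in\{1,2\}$ and $i\neq j$. If $V_i$ is a pure isometry, then $$\tilde\Pi_i = \Pi_{V_i}\Pi_V^*\in\mathcal{B}(H^2_{\mathcal{W}}(\mathbb{D}),H^2_{\mathcal{W}_i}(\mathbb{D}))$$ is a unitary operator, $$\tilde\Pi_iM_z^{\mathcal{W}} = M_{z\Theta_{V_j}}\tilde\Pi_i,\qquad \tilde\Pi_i^*M_z^{\mathcal{W}_i} = M_{\Phi_i}\tilde\Pi_i^*,$$ and $$\tilde\Pi_i(\mathbb{S}(\cdot,w)\eta) = (I_{\mathcal{W}_i}-\bar wz\Theta_{V_j}(z))^{-1}P_{\mathcal{W}_i}[I_{\mathcal{H}}+z(I_{\mathcal{H}}-zV_i^* )^{-1}V_i^*]\eta$$ for all $w\in\mathbb{D}$ and $\eta\in\mathcal{W}$, where $$\Theta_{V_j}(z)=P_{\mathcal{W}_i}(I_{\mathcal{H}}-zV_i^* )^{-1}V_j|_{\mathcal{W}_i}$$ for all $z\in\mathbb{D}$. Moreover $$\tilde\Pi_i^*(\mathbb{S}(\cdot,w)\eta_i) = (I_{\mathcal{W}}-\Phi_i(z)\bar w)^{-1}\eta_i$$ for all $w\in\mathbb{D}$ and $\eta_i\in\mathcal{W}_i$. (In these formulas the right-hand sides are the values at $z\in\mathbb{D}$ of the functions on the left.)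
   Context: $\mathbb{D}$ is the open unit disc. $P_{\mathcal{S}}$ is the orthogonal projection onto a closed subspace $\mathcal{S}$. An isometry $X$ on $\mathcal{H}$ is pure (a shift) if $X^{*m}\to0$ in the strong operator topology; its wandering subspace is $\mathcal{W}(X)=\mathcal{H}\ominus X\mathcal{H}$. For commuting isometries $(V_1,V_2)$ put $V=V_1V_2$, $\mathcal{W}=\mathcal{W}(V)$, $\mathcal{W}_j=\mathcal{W}(V_j)$ ($j=1,2$). If $V_1$ or $V_2$ is pure, then $V$ is pure. For a Hilbert space $\mathcal{E}$, $H^2_{\mathcal{E}}(\mathbb{D})$ is the Hilbert space of $\mathcal{E}$-valued analytic functions on $\mathbb{D}$ with square-summable Taylor coefficients (elements of $\mathcal{E}$ are identified with constant functions), $M_z^{\mathcal{E}}$ is multiplication by the coordinate function on it, $H^\infty_{\mathcal{B}(\mathcal{E})}(\mathbb{D})$ is the space of bounded $\mathcal{B}(\mathcal{E})$-valued holomorphic functions on $\mathbb{D}$, and $M_\Theta f=\Theta f$. $M_{z\Theta}$ is multiplication by the function $z\mapsto z\Theta(z)$. $\mathbb{S}(z,w)=(1-z\bar w)^{-1}$ is the Szegő kernel, and $\mathbb{S}(\cdot,w)\eta$ is the function $z\mapsto(1-z\bar w)^{-1}\eta$. For a pure isometry $X$ on $\mathcal{H}$, $\Pi_X:\mathcal{H}\to H^2_{\mathcal{W}(X)}(\mathbb{D})$ is the Wold-von Neumann unitary determined by $\Pi_X(X^m\eta)=z^m\eta$ ($m\ge0$, $\eta\in\mathcal{W}(X)$).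 When $V$ is pure, $\Phi_1,\Phi_2\in H^\infty_{\mathcal{B}(\mathcal{W})}(\mathbb{D})$ denote the (unique) multipliers with $\Pi_VV_k=M_{\Phi_k}\Pi_V$, $k=1,2$ (the BCL pair of $(V_1,V_2)$). When $V_i$ is pure, the function $\Theta_{V_j}$ given in the statement belongs to $H^\infty_{\mathcal{B}(\mathcal{W}_i)}(\mathbb{D})$ and satisfies $\Pi_{V_i}V_j=M_{\Theta_{V_j}}\Pi_{V_i}$. *)

(* Defs.v *)
From HB Require Import structures.
From mathcomp Require Import all_boot all_order all_algebra.
From mathcomp Require Import all_classical all_reals all_analysis.
From mathcomp.real_closed Require Export complex.

Set Implicit Arguments.
Unset Strict Implicit.
Unset Printing Implicit Defensive.
Import Order.TTheory GRing.Theory Num.Theory.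
Import numFieldNormedType.Exports.
Local Open Scope classical_set_scope.
Local Open Scope ring_scope.

(* Conventions.

   Scalars are R[i]; they carry their topology under the alias R[i]^o, and the
   norm of a normed space over R[i] takes its (real, nonnegative) values in
   R[i]. Inner products are linear in the first argument.

   A closed subspace of a Hilbert space H is a set of vectors of H, and an
   operator on such a subspace E is a function H -> H of which only the
   restriction to E is meaningful.

   An object that the mathematics determines by a property (adjoint,
   projection, inverse, Wold unitary, multipliers) is defined by the choice
   operators get / xget, whose result is arbitrary if nothing has the
   property. So every statement about such an object includes the claim that
   it exists, whenever the property is needed to prove the statement. *)

HB.mixin Record NormedModule_isHilbert (R : realType) H
    of NormedModule R[i] H := {
  hdot : H -> H -> R[i] ;
  hdot_linear : forall y, linear_for *%R (hdot ^~ y) ;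
  hdotC : forall x y, hdot y x = (hdot x y)^* ;
  hdot_norm : forall x, hdot x x = `|x| ^+ 2
}.

#[short(type="hilbertType")]
HB.structure Definition Hilbert (R : realType) :=
  {H of NormedModule_isHilbert R H & CompleteNormedModule R[i] H}.

(* A Hilbert space presented inside a module: its vectors are the elements of
   points, and ip is its inner product (meaningful on points only). The
   instances are closed subspaces of a Hilbert space and the Hardy spaces. *)
Record hspace (R : realType) := HSpace {
  ambient :> lmodType R[i] ;
  points : set ambient ;
  ip : ambient -> ambient -> R[i]
}.
Arguments HSpace {R ambient}.
Arguments points {R}.
Arguments ip {R}.

Section operators_between_spaces.
Variables (R : realType) (S T : hspace R).

Definition adjoint (A : S -> T) : T -> S := fun y =>
  xget 0 [set x | points S x /\
                  forall u, points S u -> ip T (A u) y = ip S u x].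

Definition unitary (U : S -> T) : Prop :=
  [/\ forall x, points S x -> points T (U x),
      forall (c : R[i]) x y, points S x -> points S y ->
        U (c *: x + y) = c *: U x + U y,
      forall x y, points S x -> points S y -> ip T (U x) (U y) = ip S x y
    & forall y, points T y -> exists2 x, points S x & U x = y].

End operators_between_spaces.

Section operators_on_H.
Variables (R : realType) (H : hilbertType R).
Implicit Types (E : set H) (A X : H -> H).

Definition whole : hspace R := HSpace [set: H] (@hdot R H).

Definition adj A : H -> H := adjoint (S := whole) (T := whole) A.

Definition orth_proj E : H -> H := fun x =>
  get [set y | E y /\ forall u, E u -> hdot (x - y) u = 0].

(* A restricts to an element of B(E). *)
Definition bounded_op E A : Prop :=
  [/\ forall x, E x -> E (A x),
      forall (c : R[i]) x y, E x -> E y -> A (c *: x + y) = c *: A x + A y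
    & exists c : R[i], forall x, E x -> `|A x| <= c * `|x|].

(* The inverse of A in B(E). *)
Definition op_inv E A : H -> H :=
  get [set B | bounded_op E B /\
               forall x, E x -> B (A x) = x /\ A (B x) = x].

(* X^{*m} -> 0 in the strong operator topology. *)
Definition pure X : Prop :=
  forall h, (fun m => iter m (adj X) h) @ \oo --> (0 : H).

(* The wandering subspace, the orthogonal complement of X H. *)
Definition wandering X : set H := [set x | forall h, hdot x (X h) = 0].

End operators_on_H.

Arguments whole {R}.

Definition disc (R : realType) : Type := {z : R[i] | `|z| < 1}.

Section hardy.
Variables (R : realType) (H : hilbertType R).
Implicit Types (E : set H) (f g : disc R -> H) (T : disc R -> H -> H).

Definition taylor_of f (a : nat -> H) : Prop :=
  forall z, series (fun n => sval z ^+ n *: a n) @ \oo --> f z.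

Definition taylor f : nat -> H := get (taylor_of f).

(* H^2_E(D), for a closed subspace E of H. *)
Definition hardy E : hspace R := HSpace
  [set f | exists a : nat -> H,
     [/\ forall n, E (a n),
         cvgn (series (fun n => `|a n| ^+ 2 : R[i]^o))
       & taylor_of f a]]
  (fun f g =>
     limn (series (fun n => hdot (taylor f n) (taylor g n) : R[i]^o))).

(* H^oo_{B(E)}(D); holomorphy is complex differentiability for the operator
   norm of B(E), written with explicit bounds. *)
Definition hinf E T : Prop :=
  [/\ forall z, bounded_op E (T z),
      exists M : R[i], forall z x, E x -> `|T z x| <= M * `|x|
    & forall z0, exists2 L : H -> H, bounded_op E L &
        forall eps : R[i], 0 < eps -> exists2 delta : R[i], 0 < delta &
        forall z, 0 < `|sval z - sval z0| < delta ->
        forall x, E x ->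
          `|(sval z - sval z0)^-1 *: (T z x - T z0 x) - L x| <= eps * `|x|].

(* M_T *)
Definition mult T f : disc R -> H := fun z => T z (f z).

(* M_z *)
Definition mult_z f : disc R -> H := fun z => sval z *: f z.

(* S(., w) eta *)
Definition szego (w : disc R) (eta : H) : disc R -> H :=
  fun z => (1 - sval z * (sval w)^*)^-1 *: eta.

(* The Wold-von Neumann unitary Pi_X of a pure isometry X. *)
Definition wold (X : H -> H) : H -> disc R -> H :=
  get [set P | unitary (S := whole H) (T := hardy (wandering X)) P /\
               forall m eta, wandering X eta ->
                 P (iter m X eta) = fun z => sval z ^+ m *: eta].

(* The multiplier Phi with Pi_V Y = M_Phi Pi_V, for an operator Y commuting
   with the pure isometry V; the BCL pair of (V_1, V_2) consists of
   bcl (V_1 V_2) V_1 and bcl (V_1 V_2) V_2. *)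
Definition bcl (V Y : H -> H) : disc R -> H -> H :=
  get [set Phi | hinf (wandering V) Phi /\
                 forall h, wold V (Y h) = mult Phi (wold V h)].

(* (I_H - z X^* )^{-1} *)
Definition resolvent (X : H -> H) (z : disc R) : H -> H :=
  op_inv setT (fun x => x - sval z *: adj X x).

(* Theta_{Y}(z) = P_{W(X)} (I_H - z X^* )^{-1} Y, restricted to W(X). *)
Definition theta (X Y : H -> H) : disc R -> H -> H :=
  fun z x => orth_proj (wandering X) (resolvent X z (Y x)).

End hardy.

(* Main.v *)
Require Import Defs.
From mathcomp Require Import all_boot all_order all_algebra.
From mathcomp Require Import all_classical all_reals all_analysis.
From mathcomp Require Import ring.
Import Order.TTheory GRing.Theory Num.Theory.
Import numFieldNormedType.Exports.
Local Open Scope classical_set_scope.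
Local Open Scope ring_scope.

(** For a pure isometry X, the Wold unitary has the closed form
    Pi_X h (z) = P (I - z X^* )^{-1} h, with P the projection onto
    W(X) = ker X^*; here [wold_transform X h z].  With it the theorem becomes
    algebra at each fixed z.  The product V = V_i V_j is pure as well, so every
    element of H^2_W is Pi_V h for one h in H, and Pi_V^* (Pi_V h) = h.
    Hence tPi (Pi_V h) = Pi_{V_i} h and tPi^* (Pi_{V_i} h) = Pi_V h, and each
    claim is a statement about the two transforms of a single vector h.

    Two facts about X and an isometry Y commuting with it carry the rest.
    First, h = Pi_X h (z) + (X - z) g for some g ([wold_transform_decomp]), and
    the transform vanishes at z on (X - z) H; since Y maps (X - z) H into
    itself, Pi_X (Y h) (z) = Pi_X (Y (Pi_X h (z))) (z), which is
    Theta_Y(z) (Pi_X h (z)).  This gives both intertwining relations, which say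
    Pi_{V_i} V h = z Theta_{V_j} Pi_{V_i} h and Pi_V V_i h = Phi_i Pi_V h for
    all h.  It also shows that the BCL multiplier bcl V V_i exists and is
    Theta, taken for the pair (V, V_i) ([bclE]); so one construction yields
    both multipliers.  Second, Theta_Y(z) is a contraction ([norm_theta]), which
    makes I - wbar z Theta(z) and I - wbar Phi_i(z) invertible.

    For the two Szego kernel formulas, S(., w) eta = Pi_X k for the vector k
    with k - wbar X k = eta ([szego_wold]).  Applying the other transform to
    this equation at z gives a linear equation for its value at k, whose
    solution is the stated inverse.

    Adjoints and inverses come from one existence lemma, [least_squares]: for an
    operator bounded below on a closed subspace, every vector has a best
    approximation in the range, with residual orthogonal to the range.  It gives
    the adjoint of an isometry, and also the inverse of I - c A for a
    contraction A and |c| < 1, because a vector orthogonal to the range of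
    I - c A is zero. *)

(** * Inner product and limits *)

Section InnerProduct.
Context {R : realType} {H : hilbertType R}.
Implicit Types (x y u v : H) (c : R[i]).

Lemma hdotDl x y u : hdot (x + y) u = hdot x u + hdot y u.
Proof. by have := hdot_linear u 1 x y; rewrite /= scale1r mul1r. Qed.

Lemma hdot0l u : hdot (0 : H) u = 0.
Proof. by apply: (addrI (hdot 0 u)); rewrite -hdotDl !addr0. Qed.

Lemma hdotZl c x u : hdot (c *: x) u = c * hdot x u.
Proof. by have := hdot_linear u c x 0; rewrite /= hdot0l !addr0. Qed.

Lemma hdotBl x y u : hdot (x - y) u = hdot x u - hdot y u.
Proof. by rewrite hdotDl -scaleN1r hdotZl mulN1r. Qed.

Lemma hdotDr u x y : hdot u (x + y) = hdot u x + hdot u y.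
Proof. by rewrite hdotC hdotDl rmorphD /= -!hdotC. Qed.

Lemma hdot0r u : hdot u (0 : H) = 0.
Proof. by rewrite hdotC hdot0l conjC0. Qed.

Lemma hdotZr c u x : hdot u (c *: x) = c^* * hdot u x.
Proof. by rewrite hdotC hdotZl rmorphM /= -hdotC. Qed.

Lemma hdotBr u x y : hdot u (x - y) = hdot u x - hdot u y.
Proof. by rewrite hdotC hdotBl rmorphB /= -!hdotC. Qed.

Lemma hdot_self_eq0 x : hdot x x = 0 -> x = 0.
Proof.
by move/eqP; rewrite hdot_norm expf_eq0 /= normr_eq0 => /eqP.
Qed.

Lemma hdot_inj x y : (forall u, hdot u x = hdot u y) -> x = y.
Proof.
move=> h; apply/subr0_eq/hdot_self_eq0.
by rewrite hdotBr h subrr.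
Qed.

(** The loss in norm when the component of x along y is removed.  It gives the
    Cauchy-Schwarz inequality, and the first-order condition at an approximate
    minimum in [near_minimizer]. *)
Lemma normB_proj x y : y != 0 ->
  `|x - (hdot x y / `|y| ^+ 2) *: y| ^+ 2 =
  `|x| ^+ 2 - `|hdot x y| ^+ 2 / `|y| ^+ 2.
Proof.
move=> y0; have nyR : (`|y| ^+ 2)^* = `|y| ^+ 2.
  by rewrite rmorphXn /= (CrealP (normr_real _)).
rewrite -hdot_norm hdotBl !hdotBr !hdotZl !hdotZr !hdot_norm (hdotC x y).
by rewrite fmorph_div /= nyR normCK; field; rewrite normr_eq0.
Qed.

Lemma cauchy_schwarz x y : `|hdot x y| <= `|x| * `|y|.
Proof.
have [->|y0] := eqVneq y 0; first by rewrite hdot0r normr0 mulr_ge0.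
have yp : 0 < `|y| ^+ 2 by rewrite exprn_gt0 // normr_gt0.
rewrite -(@ler_pXn2r _ 2%N) ?nnegrE ?mulr_ge0 // exprMn -ler_pdivrMr //.
by rewrite -subr_ge0 -normB_proj // exprn_ge0.
Qed.

End InnerProduct.

Section Limits.
Context {R : realType}.

Lemma near_inv_succ_lt (e : R[i]) : 0 < e ->
  \forall n \near \oo, n.+1%:R^-1 < e.
Proof.
move=> e0; have er : e = (complex.Re e)%:C%C by rewrite RRe_real // gtr0_real.
have e0' : 0 < complex.Re e by rewrite -ltcR -er.
near=> n; rewrite er -(rmorph_nat (real_complex R)) -fmorphV ltcR.
near: n; exact: near_infty_natSinv_lt (PosNum e0').
Unshelve. all: by end_near. Qed.

Lemma cvg_inv_succ : (fun n => n.+1%:R^-1 : R[i]^o) @ \oo --> (0 : R[i]^o).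
Proof.
apply/cvgrPdist_lt => e /near_inv_succ_lt; apply: filterS => n.
by rewrite sub0r normrN ger0_norm // invr_ge0 ler0n.
Qed.

(** The dominating sequence may live in another space, so that the same lemma
    transfers limits between vectors and scalars. *)
Lemma cvg_dominated (V W : normedModType R[i]) (f : nat -> V) (l : V)
    (g : nat -> W) (C : R[i]) :
  (forall n, `|l - f n| <= C * `|g n|) -> g @ \oo --> (0 : W) ->
  f @ \oo --> l.
Proof.
move=> fg /cvgrPdist_lt g0; apply/cvgrPdist_lt => e e0.
have C0 : 0 < `|C| + 1 by rewrite ltr_wpDl.
near=> n.
have gn : `|g n| < e / (`|C| + 1).
  rewrite -normrN -sub0r; near: n; apply: g0; exact: divr_gt0.
apply: le_lt_trans (fg n) _.
have Cg : 0 <= C * `|g n| by apply: le_trans (fg n).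
rewrite -(ger0_norm Cg) normrM normr_id.
rewrite ltr_pdivlMr // mulrC in gn; apply: le_lt_trans gn.
by rewrite ler_wpM2r // lerDl.
Unshelve. all: by end_near. Qed.

End Limits.

(** * Least squares in a Hilbert space *)

Lemma cauchy_cvgn {R : realType} {H : hilbertType R} (u : nat -> H) :
  (forall e : R[i], 0 < e -> exists N, forall n m, (N <= n)%N -> (N <= m)%N ->
     `|u n - u m| < e) ->
  cvgn u.
Proof.
move=> h; apply/cauchy_cvgP/cauchy_exP => e e0.
have [N hN] := h e e0; exists (u N).
by exists N => // n /= Nn; rewrite -ball_normE /=; apply: hN.
Qed.

Section LeastSquares.
Context {R : realType} {H : hilbertType R}.
Implicit Types (x y u v : H) (c : R[i]).

Definition closed_subspace (E : set H) : Prop :=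
  [/\ E 0, forall c x y, E x -> E y -> E (c *: x + y) & closed E].

Definition linear_on (E : set H) (T : H -> H) : Prop :=
  forall c x y, E x -> E y -> T (c *: x + y) = c *: T x + T y.

Variables (E : set H) (T : H -> H).
Hypothesis subE : closed_subspace E.
Hypothesis linT : linear_on E T.

Lemma linear_onB x y : E x -> E y -> T (x - y) = T x - T y.
Proof.
by move=> Ex Ey; rewrite addrC -scaleN1r linT // scaleN1r addrC.
Qed.

Lemma subspaceB x y : E x -> E y -> E (x - y).
Proof.
by case: subE => _ EZD _ Ex Ey; rewrite addrC -scaleN1r; apply: EZD.
Qed.

(** If |y - T u|^2 is within e^2 of its infimum over E, then replacing u by
    u + c v, with c T v the component of the residual along T v, gains at most
    e^2; this bounds that component. *)
Lemma near_minimizer y (e : R) : 0 < e ->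
  exists2 u, E u & forall v, E v -> `|hdot (y - T u) (T v)| <= e%:C%C * `|T v|.
Proof.
move=> e0; have [E0 EZD _] := subE.
pose d u := complex.Re (`|y - T u| ^+ 2).
have dE u : (d u)%:C%C = `|y - T u| ^+ 2.
  by rewrite RRe_real // ger0_real // exprn_ge0.
have d0 u : 0 <= d u by rewrite -lecR dE exprn_ge0.
have infD : has_inf (d @` E).
  by split; [exists (d 0), 0 | exists 0 => _ [u _ <-]].
have [_ [u Eu <-] du] := inf_adherent (exprn_gt0 2 e0) infD.
exists u => // v Ev; have [->|Tv0] := eqVneq (T v) 0.
  by rewrite hdot0r !normr0 mulr0.
have Tvp : 0 < `|T v| ^+ 2 by rewrite exprn_gt0 // normr_gt0.
set c := hdot (y - T u) (T v) / `|T v| ^+ 2.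
have := ge_inf infD.2 (ex_intro2 _ _ _ (EZD c _ _ Ev Eu) (erefl _)).
move=> /(lt_le_trans _) h; have {h} := h (d u - e ^+ 2).
rewrite ltrBlDr => /(_ du); rewrite -ltcR rmorphB rmorphXn /= !dE linT //.
rewrite opprD addrCA addrC normB_proj // ltrBlDr addrAC ltrBrDr ltrD2l.
rewrite ltr_pdivrMr // -exprMn => /ltW.
by rewrite ler_pXn2r // nnegrE // mulr_ge0 // ler0c ltW.
Qed.

(** Take e = 1/(n+1) in [near_minimizer].  Tested against v = u_n - u_m, the
    conditions at u_n and u_m subtract to
    |T (u_n - u_m)|^2 <= (1/(n+1) + 1/(m+1)) |T (u_n - u_m)|, so the bound from
    below makes u_n a Cauchy sequence; the orthogonality passes to its
    limit. *)
Lemma least_squares (C M : R[i]) y :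
  (forall x, E x -> `|x| <= C * `|T x|) ->
  (forall x, E x -> `|T x| <= M * `|x|) ->
  exists2 x, E x & forall v, E v -> hdot (y - T x) (T v) = 0.
Proof.
move=> hC hM; have [E0 EZD clE] := subE.
have e0 n : 0 < n.+1%:R^-1 :> R by rewrite invr_gt0 ltr0Sn.
have {e0} /choice [u hu] n : exists u, E u /\ forall v, E v ->
    `|hdot (y - T u) (T v)| <= n.+1%:R^-1 * `|T v|.
  have [u Eu uP] := near_minimizer y _ (e0 n); exists u; split=> // v Ev.
  by have := uP v Ev; rewrite fmorphV rmorph_nat.
have Eu n : E (u n) by have [] := hu n.
have Tdist n m : `|T (u n - u m)| <= n.+1%:R^-1 + m.+1%:R^-1.
  have [->|t0] := eqVneq (T (u n - u m)) 0.
    by rewrite normr0 addr_ge0 // invr_ge0 ler0n.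
  have tp : 0 < `|T (u n - u m)| by rewrite normr_gt0.
  rewrite -(ler_pM2r tp) -expr2 -(@ger0_norm _ (_ ^+ 2)) ?exprn_ge0 //.
  rewrite -hdot_norm {1}linear_onB //.
  have -> : T (u n) - T (u m) = (y - T (u m)) - (y - T (u n)).
    by rewrite opprB [RHS]addrC addrA subrK.
  rewrite hdotBl (le_trans (ler_normB _ _)) // addrC mulrDl lerD //.
    by case: (hu n) => _; apply; exact: subspaceB.
  by case: (hu m) => _; apply; exact: subspaceB.
have cvg_u : cvgn u.
  apply: cauchy_cvgn => e ep.
  have C0 : 0 < `|C| + 1 by rewrite ltr_wpDl.
  have [N _ hN] := near_inv_succ_lt _ (divr_gt0 (divr_gt0 ep C0) (ltr0Sn _ 1)).
  exists N => n m /hN /= en /hN /= em.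
  apply: le_lt_trans (hC _ (subspaceB _ _ (Eu n) (Eu m))) _.
  have := ltrD en em; rewrite -splitr ltr_pdivlMr // mulrC; apply: le_lt_trans.
  have := hC _ (subspaceB _ _ (Eu n) (Eu m)) => /(le_trans (normr_ge0 _)) h.
  rewrite -(ger0_norm h) normrM normr_id ler_pM ?lerDl //.
exists (lim (u @ \oo)).
  by apply: closed_cvg cvg_u => //; apply: nearW.
move=> v Ev; set x := lim _.
have Ex : E x by apply: closed_cvg cvg_u => //; apply: nearW.
have cvg_err : (fun n => u n - x) @ \oo --> (0 : H) by apply/subr_cvg0.
pose f n : R[i]^o := hdot (y - T (u n)) (T v).
have f_lim : f @ \oo --> (hdot (y - T x) (T v) : R[i]^o).
  apply: (@cvg_dominated _ R[i]^o _ f _ _ (M * `|T v|) _ cvg_err) => n.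
  have -> : hdot (y - T x) (T v) - f n = hdot (T (u n - x)) (T v).
    rewrite /f -hdotBl linear_onB //; congr hdot.
    by rewrite opprB [LHS]addrC addrA subrK.
  rewrite (le_trans (cauchy_schwarz _ _)) // mulrAC ler_wpM2r //.
  by rewrite hM //; exact: subspaceB.
have f_0 : f @ \oo --> (0 : R[i]^o).
  apply: (@cvg_dominated _ R[i]^o _ f _ _ `|T v| _ cvg_inv_succ) => n.
  rewrite sub0r normrN mulrC [X in X * _]ger0_norm ?invr_ge0 ?ler0n //.
  by case: (hu n) => _; apply.
exact: (cvg_unique (@norm_hausdorff _ R[i]^o) f_lim f_0).
Qed.

End LeastSquares.

(** * Inverses of perturbed identities and adjoints of isometries *)

Section ContractionInverse.
Context {R : realType} {H : hilbertType R}.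

Definition contraction_on (E : set H) (A : H -> H) : Prop :=
  [/\ forall x, E x -> E (A x), linear_on E A & forall x, E x -> `|A x| <= `|x|].

Variables (E : set H) (A : H -> H) (c : R[i]).
Hypothesis subE : closed_subspace E.
Hypothesis contrA : contraction_on E A.
Hypothesis c_lt1 : `|c| < 1.

Let T (x : H) : H := x - c *: A x.

Let ET x : E x -> E (T x).
Proof.
move=> Ex; have [EA _ _] := contrA; have [_ EZD _] := subE.
by rewrite /T addrC -scaleNr; apply: EZD => //; exact: EA.
Qed.

Let linT : linear_on E T.
Proof.
have [_ linA _] := contrA.
move=> a x y Ex Ey; rewrite /T linA // scalerDr opprD addrACA.
by rewrite scalerBr !scalerA [c * a]mulrC.
Qed.

Let c1 : 0 < 1 - `|c|. Proof. by rewrite subr_gt0. Qed.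

Let T_below x : E x -> `|x| <= (1 - `|c|)^-1 * `|T x|.
Proof.
move=> Ex; have [_ _ nA] := contrA.
rewrite mulrC ler_pdivlMr // mulrBr mulr1 lerBlDr.
have {1}-> : x = T x + c *: A x by rewrite /T subrK.
by rewrite (le_trans (ler_normD _ _)) // lerD2l normrZ mulrC ler_wpM2r // nA.
Qed.

Let T_above x : E x -> `|T x| <= (1 + `|c|) * `|x|.
Proof.
move=> Ex; have [_ _ nA] := contrA.
rewrite (le_trans (ler_normB _ _)) // mulrDl mul1r lerD2l normrZ.
by rewrite ler_wpM2l // nA.
Qed.

(** The residual r of [least_squares] lies in E and is orthogonal to
    r - c A r, so |r|^2 <= |c| |r|^2 and r = 0. *)
Let T_onto y : E y -> exists2 x, E x & T x = y.
Proof.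
move=> Ey; have [EA _ nA] := contrA.
have [x Ex orth] := least_squares _ _ subE linT _ _ y T_below T_above.
exists x => //; apply/esym/subr0_eq; set r := y - T x in orth *.
have Er : E r by apply: subspaceB => //; exact: ET.
have /eqP := orth r Er; rewrite /T hdotBr subr_eq0 hdot_norm => /eqP rr.
apply/eqP; rewrite -normr_eq0; apply/negPn/negP => r0.
have rp : 0 < `|r| ^+ 2 by rewrite exprn_gt0 // lt_neqAle eq_sym r0 /=.
have : `|r| ^+ 2 <= `|c| * `|r| ^+ 2.
  rewrite -[leLHS]ger0_norm ?exprn_ge0 // {1}rr hdotZr normrM norm_conjC.
  rewrite ler_wpM2l // (le_trans (cauchy_schwarz _ _)) // expr2.
  by rewrite ler_wpM2l // nA.
by rewrite -subr_le0 -{1}[_ ^+ 2]mul1r -mulrBl pmulr_lle0 // subr_le0 lt_geF.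
Qed.

Lemma op_inv_contraction (B := op_inv E (fun x => x - c *: A x)) :
  [/\ forall x, E x -> E (B x), linear_on E B,
      forall x, E x -> `|B x| <= (1 - `|c|)^-1 * `|x|,
      forall x, E x -> B (x - c *: A x) = x
    & forall x, E x -> B x - c *: A (B x) = x].
Proof.
have [E0 EZD _] := subE.
have Tinj x y : E x -> E y -> T x = T y -> x = y.
  move=> Ex Ey Txy; apply/subr0_eq/eqP; rewrite -normr_le0.
  have /le_trans := T_below _ (subspaceB _ subE _ _ Ex Ey); apply.
  by rewrite (linear_onB _ _ linT) // Txy subrr normr0 mulr0.
have : bounded_op E B /\ forall x, E x -> B (T x) = x /\ T (B x) = x.
  have /choice [S hS] y : exists x, E y -> E x /\ T x = y.
    have [Ey|nEy] := pselect (E y); last by exists 0.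
    by have [x Ex Tx] := T_onto y Ey; exists x.
  apply: (@getPex _ [set B | bounded_op E B /\
               forall x, E x -> B (T x) = x /\ T (B x) = x]).
  have ES x : E x -> E (S x) by case/hS.
  have TS x : E x -> T (S x) = x by case/hS.
  exists S; split; last first.
    move=> x Ex; split; last exact: TS.
    by apply: Tinj => //; [exact/ES/ET|exact/TS/ET].
  split=> [//|a x y Ex Ey|].
    apply: Tinj; [by apply: ES; exact: EZD|by apply: EZD; exact: ES|].
    by rewrite linT ?TS //; [exact: EZD|exact: ES|exact: ES].
  exists (1 - `|c|)^-1 => x Ex.
  by rewrite -{2}(TS _ Ex); exact/T_below/ES.
move=> [[EB linB _] TB]; split=> // x Ex; last 2 first.
- by have [] := TB x Ex.
- by have [] := TB x Ex.
have [_ <-] := TB x Ex; have [BTx _] := TB _ (EB _ Ex).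
by rewrite BTx; exact/T_below/EB.
Qed.

Lemma op_inv_eq x y : E x -> x - c *: A x = y ->
  op_inv E (fun x => x - c *: A x) y = x.
Proof. by move=> Ex <-; have [_ _ _ + _] := op_inv_contraction; apply. Qed.

End ContractionInverse.

Section Isometry.
Context {R : realType} {H : hilbertType R}.
Variable X : {linear H -> H}.
Hypothesis isoX : forall x, `|X x| = `|x|.

Lemma closed_subspace_setT : closed_subspace (@setT H).
Proof. by split=> //; exact: closedT. Qed.

Lemma hdot_iso x y : hdot (X x) (X y) = hdot x y.
Proof.
have key u v : hdot (X u) (X v) + (hdot (X u) (X v))^* =
               hdot u v + (hdot u v)^*.
  have := congr1 (fun t => t ^+ 2) (isoX (u + v)).
  rewrite /= linearD -!hdot_norm !hdotDl !hdotDr !hdot_norm !isoX.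
  rewrite (hdotC (X u)) (hdotC u) => h.
  apply: (addrI (`|u| ^+ 2)); apply: (addIr (`|v| ^+ 2)).
  by rewrite !addrA in h *.
(* A complex number is determined by the real parts of t and of conj('i) t. *)
have polar (t : R[i]) :
    t = (t + t^* + 'i * ('i^* * t + ('i^* * t)^*)) / 2.
  rewrite rmorphM /= conjCK conjCi mulrDr !mulrA mulrN -expr2 sqrCi.
  by rewrite opprK mulN1r mul1r; field.
rewrite [LHS]polar [RHS]polar key -!hdotZr -linearZ key.
by [].
Qed.

(** The least-squares solution z of X z = y satisfies (X u, y - X z) = 0 for all
    u, and (X u, X z) = (u, z); so it is the value of the adjoint at y. *)
Lemma hdot_adj x y : hdot (X x) y = hdot x (adj X y).
Proof.
have linX : linear_on setT X by move=> c u v _ _; rewrite linearP.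
have [z _ zP] : exists2 z, [set: H] z &
    forall v, [set: H] v -> hdot (y - X z) (X v) = 0.
  by apply: (least_squares _ _ closed_subspace_setT linX 1 1) => v _;
    rewrite mul1r isoX.
pose Q := [set x : H | setT x /\ forall u, setT u -> hdot (X u) y = hdot u x].
have Qz : Q z.
  split=> // u _; rewrite -(hdot_iso u z); apply/eqP; rewrite -subr_eq0 -hdotBr.
  by rewrite hdotC (zP u I) conjC0.
by have [_ ->] : Q (adj X y) by exact: (xgetPex 0 (ex_intro Q z Qz)).
Qed.

Lemma adjK x : adj X (X x) = x.
Proof. by apply: hdot_inj => u; rewrite -hdot_adj hdot_iso. Qed.

Lemma adj_linear c x y : adj X (c *: x + y) = c *: adj X x + adj X y.
Proof.
by apply: hdot_inj => u; rewrite -hdot_adj !hdotDr !hdotZr -!hdot_adj.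
Qed.

Lemma adj_zero : adj X 0 = 0.
Proof. by apply: hdot_inj => u; rewrite -hdot_adj !hdot0r. Qed.

Lemma adj_scale c x : adj X (c *: x) = c *: adj X x.
Proof. by have := adj_linear c x 0; rewrite adj_zero !addr0. Qed.

Lemma adj_sub x y : adj X (x - y) = adj X x - adj X y.
Proof. by rewrite addrC -scaleN1r adj_linear scaleN1r addrC. Qed.

Lemma norm_adj_le x : `|adj X x| <= `|x|.
Proof.
have [->|a0] := eqVneq (adj X x) 0; first by rewrite normr0.
have ap : 0 < `|adj X x| by rewrite normr_gt0.
rewrite -(ler_pM2r ap) -expr2 -hdot_norm -hdot_adj.
have : `|hdot (X (adj X x)) x| <= `|X (adj X x)| * `|x| := cauchy_schwarz _ _.
by rewrite isoX hdot_adj hdot_norm ger0_norm ?exprn_ge0 // mulrC.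
Qed.

End Isometry.

(** * The transform h |-> P (I - z X^* )^{-1} h *)

(** The closed form of the Wold unitary of X.  By definition
    [theta X Y z x] is [wold_transform X (Y x) z]. *)
Definition wold_transform {R : realType} {H : hilbertType R} (X : H -> H)
    (h : H) : disc R -> H :=
  fun z => orth_proj (wandering X) (resolvent X z h).

Section WoldTransform.
Context {R : realType} {H : hilbertType R}.
Variable X : {linear H -> H}.
Hypothesis isoX : forall x, `|X x| = `|x|.
Implicit Types (x y h eta : H) (z : disc R).

Let W := wandering X.
Let P := orth_proj W.

Lemma wanderingE x : W x <-> adj X x = 0.
Proof.
split=> [Wx|x0 h]; last by rewrite hdotC hdot_adj // x0 hdot0r conjC0.
by apply: hdot_inj => u; rewrite -hdot_adj // hdotC Wx conjC0 hdot0r.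
Qed.

Lemma closed_subspace_wandering : closed_subspace W.
Proof.
split=> [|c x y /wanderingE Wx /wanderingE Wy|].
- by apply/wanderingE; exact: adj_zero.
- by apply/wanderingE; rewrite adj_linear // Wx Wy scaler0 addr0.
- have -> : W = adj X @^-1` [set 0].
    by apply/seteqP; split=> x /wanderingE.
  apply: preimage_closed; last first.
    exact/accessible_closed_set1/hausdorff_accessible/norm_hausdorff.
  move=> x _; apply/cvgrPdist_lt => e e0; near=> y.
  rewrite -adj_sub //; apply: le_lt_trans (norm_adj_le _ isoX _) _.
  by near: y; exact: (cvgr_dist_lt id x cvg_id).
Unshelve. all: by end_near. Qed.

Lemma orth_proj_wandering x : P x = x - X (adj X x).
Proof.
have Q0 : W (x - X (adj X x)) /\
    forall u, W u -> hdot (x - (x - X (adj X x))) u = 0.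
  split; first by apply/wanderingE; rewrite adj_sub // adjK // subrr.
  by move=> u /wanderingE Wu; rewrite opprB addrCA subrr addr0 hdot_adj // Wu hdot0r.
have [Wp pP] : W (P x) /\ forall u, W u -> hdot (x - P x) u = 0.
  exact: (@getPex _ [set y | W y /\ forall u, W u -> hdot (x - y) u = 0]
    (ex_intro _ _ Q0)).
apply/subr0_eq/hdot_self_eq0; set d := _ - _.
have Wd : W d by apply: subspaceB closed_subspace_wandering _ _ Wp _; case: Q0.
have {1}-> : d = (x - (x - X (adj X x))) - (x - P x).
  by rewrite /d; move: (x - X _) => y0; rewrite opprB [RHS]addrC addrA subrK.
by rewrite hdotBl pP // Q0.2 // subrr.
Qed.

Lemma proj_in x : W (P x).
Proof. by apply/wanderingE; rewrite orth_proj_wandering adj_sub // adjK // subrr. Qed.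

Lemma proj_id x : W x -> P x = x.
Proof. by move=> /wanderingE Wx; rewrite orth_proj_wandering Wx linear0 subr0. Qed.

Lemma proj_linear c x y : P (c *: x + y) = c *: P x + P y.
Proof.
rewrite !orth_proj_wandering adj_linear // linearP opprD addrACA.
by rewrite scalerBr.
Qed.

Lemma proj_iso x : P (X x) = 0.
Proof. by rewrite orth_proj_wandering adjK // subrr. Qed.

(** Iterating this along the orbit of the adjoint telescopes; that is why the
    Wold coefficients of a pure isometry satisfy Parseval's identity. *)
Lemma hdot_proj x y : hdot (P x) (P y) = hdot x y - hdot (adj X x) (adj X y).
Proof.
rewrite !orth_proj_wandering hdotBl !hdotBr hdot_iso //.
rewrite hdot_adj // [hdot x (X _)]hdotC hdot_adj // -hdotC; ring.
Qed.

Lemma norm_proj x : `|P x| ^+ 2 = `|x| ^+ 2 - `|adj X x| ^+ 2.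
Proof. by rewrite -!hdot_norm hdot_proj. Qed.

Lemma norm_proj_le x : `|P x| <= `|x|.
Proof.
rewrite -(@ler_pXn2r _ 2%N) ?nnegrE // norm_proj.
by rewrite gerBl exprn_ge0.
Qed.

Let adj_contr : contraction_on setT (adj X).
Proof.
split=> [//|c x y _ _|x _]; [exact: adj_linear|exact: norm_adj_le].
Qed.

Lemma resolventK z x : resolvent X z (x - sval z *: adj X x) = x.
Proof.
by have [_ _ _ + _] := op_inv_contraction _ _ _ closed_subspace_setT adj_contr
  (svalP z); apply.
Qed.

Lemma resolventKV z x : resolvent X z x - sval z *: adj X (resolvent X z x) = x.
Proof.
by have [_ _ _ _] := op_inv_contraction _ _ _ closed_subspace_setT adj_contr
  (svalP z); apply.
Qed.

Lemma resolvent_linear z c x y :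
  resolvent X z (c *: x + y) = c *: resolvent X z x + resolvent X z y.
Proof.
by have [_ + _ _ _] := op_inv_contraction _ _ _ closed_subspace_setT adj_contr
  (svalP z); apply.
Qed.

Lemma norm_resolvent z x : `|resolvent X z x| <= (1 - `|sval z|)^-1 * `|x|.
Proof.
by have [_ _ + _ _] := op_inv_contraction _ _ _ closed_subspace_setT adj_contr
  (svalP z); apply.
Qed.

Lemma resolvent_unroll z x :
  resolvent X z x = x + sval z *: resolvent X z (adj X x).
Proof.
rewrite -{1}[x](subrK (sval z *: adj X x)) [X in resolvent _ _ X]addrC.
by rewrite resolvent_linear resolventK addrC.
Qed.

Notation Pi := (wold_transform X).

Lemma wold_transform_in h z : W (Pi h z).
Proof. exact: proj_in. Qed.

Lemma wold_transform_linear c h k z : Pi (c *: h + k) z = c *: Pi h z + Pi k z.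
Proof. by rewrite /wold_transform resolvent_linear -/P proj_linear. Qed.

Lemma wold_transformB h k z : Pi (h - k) z = Pi h z - Pi k z.
Proof.
by rewrite addrC -scaleN1r wold_transform_linear scaleN1r addrC.
Qed.

Lemma wold_transformZ c h z : Pi (c *: h) z = c *: Pi h z.
Proof.
have Pi0 : Pi 0 z = 0 by rewrite -[0 in LHS](subrr 0) wold_transformB subrr.
by rewrite -[c *: h in LHS]addr0 wold_transform_linear Pi0 addr0.
Qed.

Lemma wold_transform_sum (u : nat -> H) n z :
  Pi (\sum_(0 <= k < n) u k) z = \sum_(0 <= k < n) Pi (u k) z.
Proof.
elim: n => [|n IH].
  by rewrite !big_nil -[0 in LHS](subrr 0) wold_transformB subrr.
rewrite !big_nat_recr //= -IH addrC -[u n in LHS]scale1r.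
by rewrite wold_transform_linear scale1r addrC.
Qed.

Lemma wold_transform_wandering eta z : W eta -> Pi eta z = eta.
Proof.
move=> We; have /wanderingE e0 := We; rewrite /wold_transform.
rewrite -{1}[eta]subr0 -(scaler0 _ (sval z)) -e0 resolventK.
exact: proj_id.
Qed.

Lemma wold_transform_unroll h z : Pi h z = P h + sval z *: Pi (adj X h) z.
Proof.
by rewrite /wold_transform -/P resolvent_unroll addrC proj_linear addrC.
Qed.

Lemma wold_transform_shift h z : Pi (X h) z = sval z *: Pi h z.
Proof. by rewrite wold_transform_unroll proj_iso add0r adjK. Qed.

Lemma wold_transform_iter n eta z :
  W eta -> Pi (iter n X eta) z = sval z ^+ n *: eta.
Proof.
move=> We; elim: n => [|n IH] /=.
  by rewrite wold_transform_wandering // expr0 scale1r.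
by rewrite wold_transform_shift IH scalerA -exprS.
Qed.

(** With k = (I - z X^* )^{-1} h and g = X^* k, we have k = P k + X g and
    h = k - z g.  With [wold_transform_eq0] this shows that the kernel of the
    transform at z is exactly (X - z) H. *)
Lemma wold_transform_decomp h z :
  let g := adj X (resolvent X z h) in h = Pi h z + (X g - sval z *: g).
Proof.
rewrite /= /wold_transform -/P orth_proj_wandering addrA subrK.
by rewrite resolventKV.
Qed.

Lemma norm_wold_transform h z : `|Pi h z| <= (1 - `|sval z|)^-1 * `|h|.
Proof. exact: le_trans (norm_proj_le _) (norm_resolvent _ _). Qed.

Definition wold_coef h n := P (iter n (adj X) h).

Lemma wold_transform_partial h z n :
  Pi h z - series (fun k => sval z ^+ k *: wold_coef h k) n =
  sval z ^+ n *: Pi (iter n (adj X) h) z.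
Proof.
rewrite /series /=; elim: n => [|n IH].
  by rewrite big_nil subr0 expr0 scale1r.
rewrite big_nat_recr //= opprD addrA IH [in LHS]wold_transform_unroll.
by rewrite scalerDr /wold_coef addrAC subrr add0r scalerA -exprSr.
Qed.

Lemma wold_taylor h : pure X -> taylor_of (Pi h) (wold_coef h).
Proof.
move=> pX z.
apply: (@cvg_dominated _ H H _ _ _ ((1 - `|sval z|)^-1) _ (pX h)) => n.
rewrite wold_transform_partial normrZ normrX.
apply: le_trans (norm_wold_transform _ _).
by rewrite ler_piMl // exprn_ile1 // ltW // (svalP z).
Qed.

End WoldTransform.

(** * Multipliers of commuting isometries *)

Section CommutingIsometries.
Context {R : realType} {H : hilbertType R}.
Variables X Y : {linear H -> H}.
Hypothesis isoX : forall x, `|X x| = `|x|.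
Hypothesis isoY : forall x, `|Y x| = `|x|.
Hypothesis XY : forall x, X (Y x) = Y (X x).
Implicit Types (x y h eta : H) (z : disc R).

Let W := wandering X.
Notation Pi := (wold_transform X).
Notation Theta := (theta X Y).

Lemma wold_transform_eq0 g z : Pi (X g - sval z *: g) z = 0.
Proof.
rewrite addrC -scaleNr wold_transform_linear // wold_transform_shift //.
by rewrite scaleNr addrC subrr.
Qed.

(** Y maps (X - z) H into itself, so only the component Pi h z of h in the
    decomposition of [wold_transform_decomp] contributes. *)
Lemma wold_transform_theta h z : Pi (Y h) z = Theta z (Pi h z).
Proof.
rewrite {1}[h](wold_transform_decomp _ isoX h z).
set g := adj X _; rewrite linearD linearB linearZ /= -XY.
rewrite -[Y (Pi h z)]scale1r wold_transform_linear // wold_transform_eq0.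
by rewrite scale1r addr0.
Qed.

Lemma adjXY x : adj X (adj Y x) = adj Y (adj X x).
Proof. by apply: hdot_inj => u; rewrite -!hdot_adj // XY. Qed.

(** For c = conj w and eta in W(X), the transform of this k is the Szego kernel
    at w in the direction eta; see [szego_wold]. *)
Lemma szego_vector (c : R[i]) eta : `|c| < 1 -> exists k, k - c *: X k = eta.
Proof.
move=> c1.
have cX : contraction_on setT X.
  by split=> [//|a x y _ _|x _]; rewrite ?linearP // isoX.
have [_ _ _ _ h] := op_inv_contraction _ _ c closed_subspace_setT cX c1.
by eexists; exact: h.
Qed.

(** The vector k is the reproducing kernel at z in the direction eta, pulled
    back to H by the Wold unitary. *)
Lemma hdot_wold_transform h z eta k : W eta -> k - (sval z)^* *: X k = eta ->
  hdot (Pi h z) eta = hdot h k.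
Proof.
move=> We kE; have {2}-> := wold_transform_decomp _ isoX h z.
set g := adj X _; have Wp := wold_transform_in _ isoX h z.
rewrite hdotDl -kE !hdotBr hdotZr conjCK Wp mulr0 subr0.
suff -> : hdot (X g - sval z *: g) k = 0 by rewrite addr0.
rewrite hdotBl hdotZl -[hdot g k](hdot_iso _ isoX) -[sval z in LHS]conjCK.
by rewrite -hdotZr -hdotBr kE hdotC We conjC0.
Qed.

(** The eigenvectors of X^* for the eigenvalue conj z are the kernel vectors at
    z, and P m is the direction of the kernel vector m. *)
Lemma norm_sqr_eigen z m : adj X m = (sval z)^* *: m ->
  `|orth_proj W m| ^+ 2 = (1 - `|sval z| ^+ 2) * `|m| ^+ 2.
Proof.
move=> mE; rewrite (norm_proj _ isoX) mE normrZ norm_conjC exprMn.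
by rewrite mulrBl mul1r.
Qed.

(** Duality with kernel vectors.  Let k be the kernel vector at z in the
    direction y = Theta z x.  Then Y^* k is again an eigenvector of X^* for
    conj z, hence the kernel vector in the direction P (Y^* k), and
    |P (Y^* k)| <= |y| by [norm_sqr_eigen] because |Y^* k| <= |k|.  Finally
    |y|^2 = (Y x, k) = (x, P (Y^* k)) <= |x| |y|. *)
Lemma norm_theta z x : W x -> `|Theta z x| <= `|x|.
Proof.
move=> Wx; set y := Theta z x.
have [->|y0] := eqVneq y 0; first by rewrite normr0.
have Wy : W y := wold_transform_in _ isoX (Y x) z.
have zc : `|(sval z)^*| < 1 by rewrite norm_conjC (svalP z).
have [k kE] := szego_vector _ y zc.
have Xk : adj X k = (sval z)^* *: k.
  have := congr1 (adj X) kE; rewrite adj_sub // adj_scale // adjK //.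
  by move/(wanderingE _ isoX): Wy => -> /eqP; rewrite subr_eq0 => /eqP.
have Pk : orth_proj W k = y by rewrite orth_proj_wandering // Xk linearZ.
set m := adj Y k.
have Xm : adj X m = (sval z)^* *: m by rewrite adjXY Xk adj_scale.
have yp : 0 < `|y| by rewrite normr_gt0.
rewrite -(ler_pM2r yp) -expr2 -hdot_norm.
rewrite {1}/y (hdot_wold_transform (Y x) z y k) // hdot_adj // -/m.
have -> : hdot x m = hdot x (orth_proj W m).
  by rewrite orth_proj_wandering // hdotBr Wx subr0.
have le_my : `|orth_proj W m| <= `|y|.
  rewrite -(@ler_pXn2r _ 2%N) ?nnegrE // -Pk !(norm_sqr_eigen z) //.
  rewrite ler_wpM2l ?subr_ge0 ?exprn_ile1 ?(ltW (svalP z)) //.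
  by rewrite ler_pXn2r ?nnegrE // norm_adj_le.
have h0 : 0 <= hdot x (orth_proj W m).
  rewrite orth_proj_wandering // hdotBr Wx subr0 -hdot_adj //.
  by rewrite -(hdot_wold_transform (Y x) z y k) // -/(theta X Y z x) hdot_norm exprn_ge0.
rewrite -(ger0_norm h0) (le_trans (cauchy_schwarz _ _)) //.
by rewrite ler_wpM2l.
Qed.

Lemma theta_contraction z : contraction_on W (Theta z).
Proof.
split=> [x _|c x y _ _|x]; last exact: norm_theta.
- exact: wold_transform_in.
- by rewrite /theta linearP; exact: wold_transform_linear.
Qed.

(** The resolvent identity.  Used twice, it expresses the error of a
    difference quotient as (z - w) times a transform. *)
Lemma wold_transform_diff h z w : Pi h z - Pi h w =
  (sval z - sval w) *: Pi (adj X (resolvent X w h)) z.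
Proof.
set k := resolvent X w h.
have hE : h = (sval z - sval w) *: adj X k + (k - sval z *: adj X k).
  rewrite -{1}[h](resolventKV _ isoX w) -/k scalerBl.
  by rewrite [RHS]addrC addrA subrK.
rewrite {1}hE wold_transform_linear //.
suff -> : Pi (k - sval z *: adj X k) z = Pi h w by rewrite addrK.
by rewrite /wold_transform resolventK.
Qed.

Lemma theta_hinf : hinf W Theta.
Proof.
have bth z : bounded_op W (Theta z).
  have [h1 h2 h3] := theta_contraction z.
  by split=> //; exists 1 => x; rewrite mul1r; exact: h3.
split=> //; first by exists 1 => z x; rewrite mul1r; exact: norm_theta.
move=> w; pose D x := adj X (resolvent X w x).
have linD c x y : D (c *: x + y) = c *: D x + D y.
  by rewrite /D resolvent_linear // adj_linear.
have d0 : 0 < 1 - `|sval w| by rewrite subr_gt0 (svalP w).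
have normD x : `|D x| <= (1 - `|sval w|)^-1 * `|x|.
  exact: le_trans (norm_adj_le _ isoX _) (norm_resolvent _ isoX _ _).
exists (fun x => Pi (D (Y x)) w).
  split=> [x _|c x y _ _|]; first exact: wold_transform_in.
    by rewrite linearP linD wold_transform_linear.
  exists ((1 - `|sval w|)^-1 * (1 - `|sval w|)^-1) => x _.
  rewrite (le_trans (norm_wold_transform _ isoX _ _)) // -mulrA ler_wpM2l //.
    by rewrite invr_ge0 ltW.
  by rewrite -(isoY x).
set d := 1 - _ in d0 normD; move=> eps eps0.
pose s := eps * d ^+ 2; have s0 : 0 < s by rewrite mulr_gt0 // exprn_gt0.
have s1 : 0 < 1 + s by rewrite addr_gt0.
(* |z - w| < s d / (1 + s) says |z - w| <= s (d - |z - w|), and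
   d - |z - w| <= 1 - |z|. *)
exists (s * d / (1 + s)); first by rewrite divr_gt0 // mulr_gt0.
move=> z /andP[zw]; rewrite ltr_pdivlMr // => zd x _.
have zw0 : sval z - sval w != 0 by rewrite -normr_gt0.
have z1 : 0 < 1 - `|sval z| by rewrite subr_gt0 (svalP z).
have thetaE v : Theta v x = Pi (Y x) v by [].
rewrite !thetaE wold_transform_diff scalerA mulVf // scale1r.
rewrite -/(D _) wold_transform_diff -/(D _) normrZ.
apply: le_trans (_ : s * `|D (D (Y x))| <= _).
  rewrite (le_trans (ler_wpM2l _ (norm_wold_transform _ isoX _ _))) // mulrA.
  rewrite ler_wpM2r // ler_pdivrMr //.
  have : `|sval z - sval w| <= s * (d - `|sval z - sval w|).
    rewrite mulrBr lerBrDr [X in _ + X]mulrC.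
    by rewrite -{1}[`|sval z - sval w|]mulr1 -mulrDr ltW.
  move=> /le_trans; apply; rewrite ler_pM2l // /d -addrA lerD2l -opprD lerN2.
  by rewrite -{1}[sval z](subrK (sval w)) addrC ler_normD.
rewrite /s -mulrA ler_pM2l // expr2 -mulrA -(isoY x).
rewrite -!ler_pdivlMl //.
have := normD (Y x); rewrite -(@ler_pM2l _ d^-1) ?invr_gt0 //.
by apply: le_trans.
Qed.

End CommutingIsometries.

(** * Uniqueness of Taylor coefficients *)

Section TaylorUniqueness.
Context {R : realType} {H : hilbertType R}.
Implicit Types (d e : nat -> H) (s z M : R[i]).

(** The point 0 is left out so that the condition survives division by z, that
    is, the shift of the coefficients. *)
Definition null_pseries d : Prop := forall z, 0 < `|z| < 1 ->
  series (fun k => z ^+ k *: d k) @ \oo --> (0 : H).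

Lemma pseries_recl d z n : series (fun k => z ^+ k *: d k) n.+1 =
  d 0%N + z *: series (fun k => z ^+ k *: d k.+1) n.
Proof.
rewrite /series /= big_nat_recl // expr0 scale1r scaler_sumr; congr (_ + _).
by apply: eq_bigr => k _; rewrite scalerA exprS.
Qed.

(** In the Horner form e_0 + s T of the sum, the bound 2 M for T gives
    M + (2 M) / 2 = 2 M again. *)
Lemma norm_pseries_le s M e n : 0 <= s <= 2^-1 ->
  (forall k, `|e k| <= M) -> `|series (fun k => s ^+ k *: e k) n| <= 2 * M.
Proof.
move=> /andP[s0 s2] eM; have M0 : 0 <= M by apply: le_trans (eM 0%N).
elim: n e eM => [|n IH] e eM.
  by rewrite /series /= big_nil normr0 mulr_ge0.
rewrite pseries_recl (le_trans (ler_normD _ _)) // mulr2n mulrDl mul1r.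
rewrite lerD // normrZ ger0_norm // -[M in leRHS]mul1r -[1](@mulVf _ 2) //.
rewrite -mulrA ler_pM //; exact: IH.
Qed.

(** Convergence at 1/2 bounds the terms b_k = 2^{-k} d_k by some M.  At the
    point s/2 the partial sums are b_0 + s T with |T| <= 2 M, and they tend to 0; so
    |d_0| is at most of order s, for s = 1/(m+2) with m arbitrary. *)
Lemma null_pseries_head d : null_pseries d -> d 0%N = 0.
Proof.
move=> nd; pose b k := 2^-1 ^+ k *: d k : H.
have [M bM] : exists M, forall k, `|b k| <= M.
  have := nd 2^-1; rewrite ger0_norm ?invr_ge0 // invr_gt0 invf_lt1 //.
  rewrite ltr0n ltr1n => /(_ isT) cv.
  have [M [Mr hM]] := cvg_seq_bounded (cvgP _ cv).
  have hM1 : M < M + 1 by rewrite ltrDl.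
  have hM' n : `|series b n| <= M + 1 by exact: (hM _ hM1 n I).
  exists ((M + 1) + (M + 1)) => k.
  have -> : b k = series b k.+1 - series b k.
    by rewrite /series /= big_nat_recr //= addrAC subrr add0r.
  by rewrite (le_trans (ler_normB _ _)) // lerD.
suff bound m : `|d 0%N| <= (2 * M + 1) * m.+1%:R^-1.
  have : (fun _ : nat => 0 : H) @ \oo --> d 0%N.
    apply: (@cvg_dominated _ H R[i]^o _ _ _ (2 * M + 1) _ cvg_inv_succ) => m.
    by rewrite subr0 [`|_^-1|]ger0_norm ?invr_ge0 ?ler0n.
  by move=> /(cvg_unique (@norm_hausdorff _ H)); apply; exact: cvg_cst.
pose s : R[i] := m.+2%:R^-1.
have s0 : 0 < s by rewrite invr_gt0 ltr0n.
have s2 : s <= 2^-1 by rewrite lef_pV2 ?posrE ?ltr0n // ler_nat.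
have half1 : s * 2^-1 < 1.
  apply: le_lt_trans (_ : 1 * 2^-1 < 1); last by rewrite mul1r invf_lt1 // ltr1n.
  by rewrite ler_pM2r ?invr_gt0 // invf_le1 // ler1n.
have m0 : 0 < m.+1%:R^-1 :> R[i] by rewrite invr_gt0 ltr0n.
have := nd (s * 2^-1); rewrite gtr0_norm ?mulr_gt0 ?invr_gt0 ?ltr0n //.
move=> /(_ half1) /cvgrPdist_lt /(_ _ m0) [N _ hN].
have := hN N.+1 (leqnSn N); rewrite /= sub0r normrN.
have -> : series (fun k => (s / 2) ^+ k *: d k) = series (fun k => s ^+ k *: b k).
  by congr series; apply/funext => k; rewrite /b scalerA exprMn.
rewrite pseries_recl => /ltW h.
have hb : `|series (fun k => s ^+ k *: b k.+1) N| <= 2 * M.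
  by apply: norm_pseries_le => [|k]; [rewrite s2 ltW|exact: bM].
have -> : d 0%N = b 0%N + s *: series (fun k => s ^+ k *: b k.+1) N
                - s *: series (fun k => s ^+ k *: b k.+1) N.
  by rewrite addrK /b expr0 scale1r.
rewrite (le_trans (ler_normB _ _)) // addrC mulrDl mul1r lerD //.
rewrite normrZ gtr0_norm // mulrC ler_pM ?(ltW s0) //.
by rewrite lef_pV2 ?posrE ?ltr0n // ler_nat.
Qed.

Lemma null_pseries_shift d : null_pseries d -> null_pseries (fun k => d k.+1).
Proof.
move=> nd z zP; have d0 := null_pseries_head d nd.
have z0 : z != 0 by case/andP: zP => + _; rewrite normr_gt0.
have := nd z zP; rewrite -cvg_shiftS => h.
apply: (@cvg_dominated _ H H _ _ _ `|z^-1| _ h) => n.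
rewrite /= pseries_recl d0 sub0r add0r normrN normrZ mulrA -normrM.
by rewrite mulVf // normr1 mul1r.
Qed.

Lemma null_pseries_eq0 d n : null_pseries d -> d n = 0.
Proof.
elim: n d => [|n IH] d nd; first exact: null_pseries_head.
exact: IH (null_pseries_shift d nd).
Qed.

Lemma taylor_unique (f : disc R -> H) a b :
  taylor_of f a -> taylor_of f b -> a = b.
Proof.
move=> fa fb; apply/funext => n; apply/subr0_eq.
apply: (null_pseries_eq0 (fun k => a k - b k)) => z /andP[_ z1].
have -> : series (fun k => z ^+ k *: (a k - b k)) =
    series (fun k => z ^+ k *: a k) - series (fun k => z ^+ k *: b k).
  apply/funext => m; rewrite /series /= !fctE -sumrB.
  by apply: eq_bigr => k _; rewrite scalerBr.
rewrite -(subrr (f (exist _ z z1))).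
exact: cvgB (fa (exist _ z z1)) (fb (exist _ z z1)).
Qed.

Lemma taylor_eq (f : disc R -> H) a : taylor_of f a -> taylor f = a.
Proof.
move=> fa; apply: (taylor_unique f) => //.
exact: (@getPex _ (taylor_of f) (ex_intro _ a fa)).
Qed.

End TaylorUniqueness.

(** * The Wold unitary *)

Section WoldUnitary.
Context {R : realType} {H : hilbertType R}.
Variable X : {linear H -> H}.
Hypothesis isoX : forall x, `|X x| = `|x|.
Hypothesis pureX : pure X.
Implicit Types (x y h eta : H) (z : disc R).

Let W := wandering X.
Notation Pi := (wold_transform X).
Notation coef := (wold_coef X).

Lemma wold_coef_in h n : W (coef h n).
Proof. exact: proj_in. Qed.

(** The partial sums telescope to hdot x y - hdot (X^{*n} x) (X^{*n} y). *)
Lemma wold_parseval x y :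
  series (fun n => hdot (coef x n) (coef y n) : R[i]^o) @ \oo -->
  (hdot x y : R[i]^o).
Proof.
apply: (@cvg_dominated _ R[i]^o H _ _ _ `|y| _ (pureX x)) => n.
have -> : hdot x y - series (fun n => hdot (coef x n) (coef y n) : R[i]^o) n =
          hdot (iter n (adj X) x) (iter n (adj X) y).
  rewrite /series /=; elim: n => [|n IH]; first by rewrite big_nil subr0.
  by rewrite big_nat_recr //= opprD addrA IH hdot_proj // opprB addrCA subrr addr0.
rewrite (le_trans (cauchy_schwarz _ _)) // mulrC ler_wpM2r //.
elim: n => [//|n IH] /=; exact: le_trans (norm_adj_le _ isoX _) IH.
Qed.

Lemma wold_transform_ip x y : ip (hardy W) (Pi x) (Pi y) = hdot x y.
Proof.
rewrite /= !(taylor_eq _ _ (wold_taylor _ isoX _ pureX)).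
exact: (cvg_lim (@norm_hausdorff _ R[i]^o) (wold_parseval x y)).
Qed.

(** The first term lies in W and the others in the range of X, hence Pythagoras
    and induction on the shifted sequence. *)
Lemma norm_wandering_sum (a : nat -> H) N : (forall n, W (a n)) ->
  `|\sum_(0 <= k < N) iter k X (a k)| ^+ 2 = \sum_(0 <= k < N) `|a k| ^+ 2.
Proof.
elim: N a => [|N IH] a Wa; first by rewrite !big_nil normr0 expr0n.
rewrite !big_nat_recl //= -(linear_sum X).
rewrite -IH => [|n]; last exact: Wa.
rewrite -!hdot_norm hdotDl !hdotDr Wa hdot_iso // [hdot (X _) _]hdotC Wa.
by rewrite conjC0 add0r addr0.
Qed.

Lemma norm_iter n x : `|iter n X x| = `|x|.
Proof. by elim: n => //= n IH; rewrite isoX. Qed.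

Lemma iter_sum n m (u : nat -> H) :
  iter n X (\sum_(0 <= k < m) u k) = \sum_(0 <= k < m) iter n X (u k).
Proof. by elim: n => [//|n IH]; rewrite iterS IH linear_sum. Qed.

Lemma norm_wandering_tail (a : nat -> H) n m : (forall n, W (a n)) ->
  `|\sum_(n <= k < m) iter k X (a k)| ^+ 2 = \sum_(n <= k < m) `|a k| ^+ 2.
Proof.
move=> Wa; rewrite -[n]add0n !big_addn.
rewrite -(norm_wandering_sum (fun k => a (k + n)%N)) //.
rewrite -[in RHS](norm_iter n) iter_sum; congr (`|_| ^+ 2).
by apply: eq_bigr => k _; rewrite -iterD addnC.
Qed.

(** The vector with coefficients a is the sum of the X^k a_k; it converges
    because its tails have the same norms as those of the sequence a. *)
Lemma wold_transform_onto f : points (hardy W) f -> exists h, Pi h = f.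
Proof.
case=> a [Wa sqa fa]; pose u k := iter k X (a k).
have /cauchy_cvgP/cvg_ex[h hu] : cauchy (series u @ \oo).
  apply/cauchy_seriesP => e e0.
  have /cauchy_seriesP/(_ _ (exprn_gt0 2 e0)) :
      cauchy (series (fun n => `|a n| ^+ 2 : R[i]^o) @ \oo).
    by apply: cvg_cauchy.
  apply: filterS => -[n m] /=; rewrite -norm_wandering_tail //.
  by rewrite ger0_norm ?exprn_ge0 // ltr_pXn2r // nnegrE // ltW.
exists h; apply/funext => z.
have cv : (fun n => Pi (series u n) z) @ \oo --> Pi h z.
  have hu0 : (fun n => series u n - h) @ \oo --> (0 : H) by apply/subr_cvg0.
  apply: (@cvg_dominated _ H H _ _ _ ((1 - `|sval z|)^-1) _ hu0) => n.
  by rewrite -wold_transformB // [X in _ * X]distrC; exact: (norm_wold_transform _ isoX).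
apply: (cvg_unique (@norm_hausdorff _ H) cv).
have -> : (fun n => Pi (series u n) z) = series (fun n => sval z ^+ n *: a n).
  apply/funext => n; rewrite /series /= wold_transform_sum //.
  by apply: eq_bigr => k _; rewrite wold_transform_iter //; exact: Wa.
exact: fa.
Qed.

Lemma wold_transform_unitary :
  unitary (S := whole H) (T := hardy W) Pi.
Proof.
split=> [x _|c x y _ _|x y _ _|f /wold_transform_onto [h <-]].
- exists (coef x); split; [exact: wold_coef_in| |exact: wold_taylor].
  have -> : (fun n => `|coef x n| ^+ 2 : R[i]^o) =
      (fun n => hdot (coef x n) (coef x n) : R[i]^o).
    by apply/funext => n; rewrite hdot_norm.
  exact: cvgP (wold_parseval x x).
- by apply/funext => z; exact: wold_transform_linear.
- exact: wold_transform_ip.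
- by exists h.
Qed.

Lemma hdot_iter x h n : hdot x (iter n X h) = hdot (iter n (adj X) x) h.
Proof.
elim: n x => [//|n IH] x; rewrite iterS hdotC hdot_adj // -hdotC.
by rewrite IH -iterSr.
Qed.

Lemma taylor_monomial eta n :
  taylor (fun z : disc R => sval z ^+ n *: eta) =
  (fun k => if k == n then eta else 0).
Proof.
apply: taylor_eq => z; apply: (@cvg_near_cst _ _ _ _ _) .
exists n.+1 => //= m; rewrite /series /= => nm; apply/eqP.
rewrite (bigD1_seq n) ?iota_uniq ?mem_index_iota //= eqxx big1 ?addr0 //.
by move=> k /negPf ->; rewrite scaler0.
Qed.

(** Pairing P h with P (X^n d) = z^n d, and using that P is isometric,
    determines the n-th Taylor coefficient of P h in every direction d of W. *)
Lemma wold_unique (P : H -> disc R -> H) :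
  unitary (S := whole H) (T := hardy W) P ->
  (forall m eta, W eta -> P (iter m X eta) = fun z => sval z ^+ m *: eta) ->
  P = Pi.
Proof.
move=> [Pin _ Pip _] PX; apply/funext => h; apply/funext => z.
have [a [Wa _ ha]] := Pin h I.
suff aE : a = coef h.
  apply: (cvg_unique (@norm_hausdorff _ H) (ha z)).
  by rewrite aE; exact: wold_taylor.
apply/funext => n; apply/subr0_eq/hdot_self_eq0; set d := _ - _.
have Wd : W d.
  exact: subspaceB (closed_subspace_wandering _ isoX) _ _ (Wa n) (wold_coef_in _ _).
have := Pip h (iter n X d) I I; rewrite /= PX // (taylor_eq _ _ ha).
rewrite taylor_monomial hdot_iter.
have -> : limn (series (fun k => hdot (a k) (if k == n then d else 0) : R[i]^o))
          = hdot (a n) d.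
  apply: (cvg_lim (@norm_hausdorff _ R[i]^o)); apply: (@cvg_near_cst _ _ _ _ _).
  exists n.+1 => //= m; rewrite /series /= => nm; apply/eqP.
  rewrite (bigD1_seq n) ?iota_uniq ?mem_index_iota //= eqxx big1 ?addr0 //.
  by move=> k /negPf ->; rewrite hdot0r.
rewrite {3}/d hdotBl => ->; rewrite /wold_coef orth_proj_wandering // hdotBl.
by rewrite opprB addrCA subrr addr0 hdotC Wd conjC0.
Qed.

Lemma woldE : wold X = Pi.
Proof.
pose S := [set P | unitary (S := whole H) (T := hardy W) P /\
  forall m eta, W eta -> P (iter m X eta) = fun z => sval z ^+ m *: eta].
have SPi : S Pi.
  split; first exact: wold_transform_unitary.
  by move=> m eta We; apply/funext => z; exact: wold_transform_iter.
have [] : S (wold X) by exact: (@getPex _ S (ex_intro _ _ SPi)).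
exact: wold_unique.
Qed.

End WoldUnitary.

(** * The pair of transforms of a commuting pair *)

(** What the uniqueness of adjoints needs from an inner product; it is not part
    of the notion of hspace. *)
Definition separating {R : realType} (S : hspace R) : Prop :=
  forall x y, points S x -> points S y ->
    (forall u, points S u -> ip S u x = ip S u y) -> x = y.

Lemma adjointK {R : realType} (S T : hspace R) (U : S -> T) x :
  separating S -> unitary U -> points S x -> adjoint U (U x) = x.
Proof.
move=> sepS [_ _ Uip _] Sx.
pose Q := [set y | points S y /\
  forall u, points S u -> ip T (U u) (U x) = ip S u y].
have [Sa Pa] : Q (adjoint U (U x)).
  by apply: (xgetPex 0 (ex_intro Q x _)); split=> // u Su; exact: Uip.
by apply: sepS => // u Su; rewrite -Pa // Uip.
Qed.

Lemma separating_whole {R : realType} (H : hilbertType R) : separating (whole H).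
Proof. by move=> x y _ _ xy; apply: hdot_inj => u; exact: xy. Qed.

Section Multipliers.
Context {R : realType} {H : hilbertType R}.
Variable X : {linear H -> H}.
Hypothesis isoX : forall x, `|X x| = `|x|.
Hypothesis pureX : pure X.

Notation Pi := (wold_transform X).
Notation W := (wandering X).

Lemma hardy_wold f : points (hardy W) f -> exists h, f = Pi h.
Proof. by move=> /(wold_transform_onto _ isoX) [h <-]; exists h. Qed.

Lemma wold_in_hardy h : points (hardy W) (Pi h).
Proof. by have [+ _ _ _] := wold_transform_unitary _ isoX pureX; apply. Qed.

Lemma separating_hardy : separating (hardy W).
Proof.
move=> _ _ /hardy_wold [x ->] /hardy_wold [y ->] xy; congr Pi.
apply: hdot_inj => u; have := xy _ (wold_in_hardy u).
by rewrite !wold_transform_ip.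
Qed.

Lemma mult_z_wold h : mult_z (Pi h) = Pi (X h).
Proof. by apply/funext => z; rewrite wold_transform_shift. Qed.

(** Transforming k - wbar X k = eta gives (1 - z wbar) Pi k (z) = eta. *)
Lemma szego_wold w eta k : W eta -> k - (sval w)^* *: X k = eta ->
  szego w eta = Pi k.
Proof.
move=> We kE; apply/funext => z; rewrite /szego.
have zw : 1 - sval z * (sval w)^* != 0.
  rewrite subr_eq0; apply/negP => /eqP /(congr1 Num.norm).
  rewrite normr1 normrM norm_conjC => /eqP; rewrite gt_eqF //.
  by rewrite mulr_ilt1 // ?(svalP z) ?(svalP w).
have := wold_transform_wandering _ isoX eta z We.
rewrite -{1}kE wold_transformB // wold_transformZ // wold_transform_shift //.
rewrite scalerA [(sval w)^* * _]mulrC.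
rewrite -{1}[Pi k z]scale1r -scalerBl => <-.
by rewrite scalerA mulVf // scale1r.
Qed.

(** Theta is a multiplier with the defining property of the BCL multiplier, so
    one exists.  Any such multiplier is determined on W by its action on the
    constant functions, which are the transforms of the vectors of W. *)
Lemma bclE (Y : {linear H -> H}) z x : (forall x, `|Y x| = `|x|) ->
  (forall x, X (Y x) = Y (X x)) -> W x -> bcl X Y z x = theta X Y z x.
Proof.
move=> isoY XY Wx.
pose S := [set Phi | hinf W Phi /\
  forall h, wold X (Y h) = mult Phi (wold X h)].
have [_ h] : S (bcl X Y).
  apply: (@getPex _ S); exists (theta X Y); split; first exact: theta_hinf.
  move=> h; rewrite woldE //; apply/funext => u; exact: wold_transform_theta.
have := congr1 (fun f => f z) (h x).
by rewrite woldE // /mult (wold_transform_wandering _ isoX x).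
Qed.

End Multipliers.

Section Pair.
Context {R : realType} {H : hilbertType R}.
Variables X Y : {linear H -> H}.
Hypothesis isoX : forall x, `|X x| = `|x|.
Hypothesis isoY : forall x, `|Y x| = `|x|.
Hypothesis XY : forall x, X (Y x) = Y (X x).
Hypothesis pureX : pure X.

Let V : {linear H -> H} := X \o Y.

Let isoV x : `|V x| = `|x|. Proof. by rewrite /= isoX isoY. Qed.

Let VX x : V (X x) = X (V x). Proof. by rewrite /= -XY. Qed.

(** The adjoints commute, so |V^{*n} h| = |Y^{*n} X^{*n} h| <= |X^{*n} h|. *)
Lemma pure_comp : pure V.
Proof.
have adjV x : adj V x = adj Y (adj X x).
  by apply: hdot_inj => u; rewrite -!hdot_adj.
have swap n x : iter n (adj X) (adj Y x) = adj Y (iter n (adj X) x).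
  by elim: n => [//|n IH]; rewrite !iterS IH adjXY.
have le_iter n x : `|iter n (adj V) x| <= `|iter n (adj X) x|.
  elim: n x => [//|n IH] x; rewrite !iterSr adjV (le_trans (IH _)) //.
  by rewrite swap norm_adj_le.
move=> h; apply: (@cvg_dominated _ H H _ _ _ 1 _ (pureX h)) => n.
by rewrite sub0r normrN mul1r.
Qed.

Let pureV := pure_comp.
Let W := wandering V.
Let Wi := wandering X.
Let PV := wold_transform V.
Let PX := wold_transform X.

Let tPi : (disc R -> H) -> (disc R -> H) := fun f =>
  wold X (adjoint (S := whole H) (T := hardy W) (wold V) f).

Let tPi_adj := adjoint (S := hardy W) (T := hardy Wi) tPi.

Lemma tPiE h : tPi (PV h) = PX h.
Proof.
rewrite /tPi !woldE //; congr (wold_transform X _).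
apply: (@adjointK _ (whole H) (hardy W) PV) => //; first exact: separating_whole.
exact: wold_transform_unitary.
Qed.

Lemma tPi_unitary : unitary (S := hardy W) (T := hardy Wi) tPi.
Proof.
have hV f : points (hardy W) f -> exists h, f = PV h := hardy_wold _ isoV f.
split=> [_ /hV [h ->]|c _ _ /hV [x ->] /hV [y ->]|_ _ /hV [x ->] /hV [y ->]|].
- by rewrite tPiE; exact: wold_in_hardy.
- have -> : c *: PV x + PV y = PV (c *: x + y).
    by apply/funext => z; rewrite /PV wold_transform_linear.
  by rewrite !tPiE; apply/funext => z; rewrite /PX wold_transform_linear.
- by rewrite !tPiE /PX /PV !wold_transform_ip.
- move=> _ /(hardy_wold _ isoX) [h ->]; exists (PV h); last exact: tPiE.
  exact: wold_in_hardy.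
Qed.

Lemma tPi_adjE h : tPi_adj (PX h) = PV h.
Proof.
rewrite -tPiE; apply: (@adjointK _ (hardy W) (hardy Wi)).
- exact: separating_hardy.
- exact: tPi_unitary.
- exact: wold_in_hardy.
Qed.

Lemma tPi_intertwines f : points (hardy W) f ->
  tPi (mult_z f) = mult (fun z x => sval z *: theta X Y z x) (tPi f).
Proof.
move=> /(hardy_wold _ isoV) [h ->]; rewrite mult_z_wold // !tPiE.
apply/funext => z; rewrite /mult -wold_transform_theta //.
by rewrite /PX /= wold_transform_shift.
Qed.

Lemma tPi_adj_intertwines f : points (hardy Wi) f ->
  tPi_adj (mult_z f) = mult (bcl V X) (tPi_adj f).
Proof.
move=> /(hardy_wold _ isoX) [h ->]; rewrite mult_z_wold // !tPi_adjE.
apply/funext => z; rewrite /mult bclE //; last exact: wold_transform_in.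
by rewrite -wold_transform_theta.
Qed.

(** Let k be the vector whose V-transform is the Szego kernel.  The argument of
    the inverse is the X-transform of eta = k - wbar X (Y k) at z, which equals
    (I - wbar z Theta(z)) applied to the X-transform of k. *)
Lemma tPi_szego w eta z : W eta ->
  tPi (szego w eta) z =
  op_inv Wi (fun x => x - ((sval w)^* * sval z) *: theta X Y z x)
    (orth_proj Wi (eta + sval z *: resolvent X z (adj X eta))).
Proof.
move=> We; have wc : `|(sval w)^*| < 1 by rewrite norm_conjC (svalP w).
have [k kE] := szego_vector _ isoV _ eta wc.
rewrite (szego_wold _ isoV w eta k) // tPiE -resolvent_unroll //.
apply/esym/op_inv_eq.
- exact: closed_subspace_wandering.
- exact: theta_contraction.
- by rewrite normrM mulr_ilt1 // (svalP z).
- exact: wold_transform_in.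
rewrite -wold_transform_theta // -scalerA -wold_transform_shift //.
by rewrite -wold_transformZ // -wold_transformB // kE.
Qed.

(** As for [tPi_szego], with the roles of X and V exchanged: now
    eta = k - wbar X k, and W(X) is contained in W(V), so eta is its own
    V-transform. *)
Lemma tPi_adj_szego w eta z : Wi eta ->
  tPi_adj (szego w eta) z =
  op_inv W (fun x => x - (sval w)^* *: bcl V X z x) eta.
Proof.
move=> We; have wc : `|(sval w)^*| < 1 by rewrite norm_conjC (svalP w).
have [k kE] := szego_vector _ isoX _ eta wc.
rewrite (szego_wold _ isoX w eta k) // tPi_adjE.
have Weta : W eta by move=> h; exact: We.
have bclC : contraction_on W (bcl V X z).
  have [h1 h2 h3] := theta_contraction _ _ isoV isoX VX z.
  have [_ WZD _] := closed_subspace_wandering _ isoV.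
  split=> [x Wx|c x y Wx Wy|x Wx]; rewrite !bclE //; try exact: WZD.
  - exact: h1.
  - exact: h2.
  - exact: h3.
apply/esym/op_inv_eq => //.
- exact: closed_subspace_wandering.
- exact: wold_transform_in.
rewrite bclE //; last exact: wold_transform_in.
rewrite -wold_transform_theta // -wold_transformZ // -wold_transformB // kE.
exact: wold_transform_wandering.
Qed.

End Pair.

Theorem theorem5p1 (R : realType) (H : hilbertType R)
    (V_ : 'I_2 -> {linear H -> H})
    (isometry_V : forall k x, `|V_ k x| = `|x|)
    (commute_V : forall x, V_ 0 (V_ 1 x) = V_ 1 (V_ 0 x))
    (i j : 'I_2) (neq_ij : i != j)
    (pure_Vi : pure (V_ i)) :
  let V : H -> H := fun x => V_ 0 (V_ 1 x) in
  let W := wandering V in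
  let Wi := wandering (V_ i) in
  let Phi_i := bcl V (V_ i) in
  let Theta_j := theta (V_ i) (V_ j) in
  let Pi_V_adj : (disc R -> H) -> H :=
    adjoint (S := whole H) (T := hardy W) (wold V) in
  let tPi : (disc R -> H) -> (disc R -> H) :=
    fun f => wold (V_ i) (Pi_V_adj f) in
  let tPi_adj : (disc R -> H) -> (disc R -> H) :=
    adjoint (S := hardy W) (T := hardy Wi) tPi in
  [/\ unitary (S := hardy W) (T := hardy Wi) tPi,
      forall f : disc R -> H, points (hardy W) f ->
        tPi (mult_z f) = mult (fun z x => sval z *: Theta_j z x) (tPi f),
      forall f : disc R -> H, points (hardy Wi) f ->
        tPi_adj (mult_z f) = mult Phi_i (tPi_adj f),
      forall (w : disc R) (eta : H), W eta -> forall z : disc R,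
        tPi (szego w eta) z =
        op_inv Wi (fun x => x - ((sval w)^* * sval z) *: Theta_j z x)
          (orth_proj Wi
             (eta + sval z *: resolvent (V_ i) z (adj (V_ i) eta)))
    & forall (w : disc R) (eta_i : H), Wi eta_i -> forall z : disc R,
        tPi_adj (szego w eta_i) z =
        op_inv W (fun x => x - (sval w)^* *: Phi_i z x) eta_i].
Proof.
move=> V.
have ord2 (k : 'I_2) : k = 0 \/ k = 1.
  by case: k => [[|[|//]] lt_k]; [left|right]; apply: val_inj.
have [Vij VE] : (forall x, V_ i (V_ j x) = V_ j (V_ i x)) /\
    V = (V_ i \o V_ j : {linear H -> H}).
  move: neq_ij; case: (ord2 i) (ord2 j) => -> [] -> //= _; split=> //.
  by apply/funext => x /=; rewrite -commute_V.
rewrite {}VE => W Wi Phi_i Theta_j Pi_V_adj tPi tPi_adj; split.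
- exact: tPi_unitary.
- exact: tPi_intertwines.
- exact: tPi_adj_intertwines.
- by move=> w eta We z; exact: tPi_szego.
- by move=> w eta We z; exact: tPi_adj_szego.
Qed.
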